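(* There exist equivalence relations $R$ and $S$ on $\omega$, each with infinitely many equivalence classes, such that the reducibility spectrum $\mathrm{DgSp}_{\Rightarrow}(R,S)$ has no countable basis (that is, no finite or countably infinite set of Turing degrees is a basis of $\mathrm{DgSp}_{\Rightarrow}(R,S)$).
   Context: For equivalence relations $R,S$ on $\omega$ and a Turing degree $\mathbf{d}$, write $R\leq_{\mathbf{d}} S$ if there is a $\mathbf{d}$-computable function $f:\omega\to\omega$ such that for all $x,y\in\omega$, $x R y \Leftrightarrow f(x) S f(y)$. The reducibility spectrum of $(R,S)$ is $\mathrm{DgSp}_{\Rightarrow}(R,S)=\{\mathbf{d} : R\leq_{\mathbf{d}} S\}$. A set $\mathcal{B}$ of Turing degrees is a basis of a set $\mathcal{A}$ of Turing degrees if (1) the elements of $\mathcal{B}$ are pairwise Turing-incomparable, and (2) $\mathcal{A}=\{\mathbf{d} : (\exists \mathbf{b}\in\mathcal{B})(\mathbf{b}\leq\mathbf{d})\}$. *)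

(* Defs.v *)
From mathcomp Require Import all_boot.
From mathcomp Require Import boolp classical_sets functions cardinality.
From Stdlib Require Import RelationClasses.

Set Implicit Arguments.
Unset Strict Implicit.
Unset Printing Implicit Defensive.

Local Open Scope classical_set_scope.

(* Kleene's schemes for the partial recursive functions with an oracle; the
   index is the arity. *)
Inductive code : nat -> Type :=
| Zero n : code n
| Succ : code 1
| Proj n (i : 'I_n) : code n
| Oracle : code 1
| Comp m n (f : code m) (g : 'I_m -> code n) : code n
| PrimRec n (f : code n) (g : code n.+2) : code n.+1
| Mu n (f : code n.+1) : code n.

Fixpoint primrec_graph n (F : n.-tuple nat -> nat -> Prop)
    (G : n.+2.-tuple nat -> nat -> Prop) (k : nat) (x : n.-tuple nat)
    (y : nat) : Prop :=
  if k is j.+1 then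
    exists2 z, primrec_graph F G j x z & G [tuple of j :: z :: x] y
  else F x y.

(* [eval A c x y]: the program [c] with oracle [A] halts on [x] with output
   [y].  In [PrimRec] the recursion variable is the first argument, in [Mu] it
   is the minimized variable that comes first. *)
Fixpoint eval (A : pred nat) n (c : code n) : n.-tuple nat -> nat -> Prop :=
  match c in code n return n.-tuple nat -> nat -> Prop with
  | Zero _ => fun _ y => y = 0
  | Succ => fun x y => y = (thead x).+1
  | Proj _ i => fun x y => y = tnth x i
  | Oracle => fun x y => y = A (thead x)
  | Comp m _ f g => fun x y =>
      exists2 v : m.-tuple nat,
        forall i, eval A (g i) x (tnth v i) & eval A f v y
  | PrimRec _ f g => fun x y =>
      primrec_graph (eval A f) (eval A g) (thead x) [tuple of behead x] y
  | Mu _ f => fun x y =>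
      eval A f [tuple of y :: x] 0 /\
      forall z, z < y -> exists v, eval A f [tuple of z :: x] v.+1
  end.

Definition computable_in (A : pred nat) (f : nat -> nat) : Prop :=
  exists c : code 1, forall x, eval A c [tuple x] (f x).

Definition turing_le (A B : pred nat) : Prop :=
  computable_in B (fun x => nat_of_bool (A x)).

Definition turing_equiv (A B : pred nat) : Prop :=
  turing_le A B /\ turing_le B A.

Record turing_degree := TuringDegree {
  degree_class : set (pred nat);
  degree_classP : exists A, degree_class = [set B | turing_equiv A B] }.

Definition degree_le (a b : turing_degree) : Prop :=
  exists A B, [/\ degree_class a A, degree_class b B & turing_le A B].

Definition degree_computable (d : turing_degree) (f : nat -> nat) : Prop :=
  exists2 A, degree_class d A & computable_in A f.

Definition reducible (d : turing_degree) (R S : nat -> nat -> Prop) : Prop :=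
  exists2 f, degree_computable d f & forall x y, R x y <-> S (f x) (f y).

Definition DgSp (R S : nat -> nat -> Prop) : set turing_degree :=
  [set d | reducible d R S].

Definition is_basis (B A : set turing_degree) : Prop :=
  (forall a b, B a -> B b -> a <> b -> ~ degree_le a b /\ ~ degree_le b a) /\
  A = [set d | exists2 b, B b & degree_le b d].

Definition classes (R : nat -> nat -> Prop) : set (set nat) :=
  range (fun x => [set y | R x y]).

(* Main.v *)
Require Import Defs.
From mathcomp Require Import all_boot.
From mathcomp Require Import boolp classical_sets functions cardinality.
From Stdlib Require Import RelationClasses Eqdep_dec.

(* Take R to be equality and let S collapse the complement of a set X to one
   class: a reduction from R to S is an injection that takes at most one value
   outside X, so the spectrum consists of the degrees that compute an infinite
   subset of X.  For a finite set s and a program e, either there are oracles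
   extending s by arbitrarily large elements on which e takes different values
   at the same argument, or beyond some bound all such oracles on which e
   computes a set yield the same set H.  There are only countably many such
   sets H, so a Cohen-generic X has no infinite subset computable in one of
   them, and it contains a splitting extension of s whenever these exist
   arbitrarily far.  If B were a countable basis, each of its degrees would
   compute an infinite subset of X, hence would contain none of the sets H.
   One then builds an infinite subset Y of X computing no element of B, by
   choosing for every e either the half of a splitting pair that gives a wrong
   value or a bound beyond which e can only compute some H.  The degree of Y is
   in the spectrum but above no element of B. *)

Set Implicit Arguments.
Unset Strict Implicit.
Unset Printing Implicit Defensive.

(** * Countability of the programs *)

Fixpoint code_tree n (c : code n) : GenTree.tree nat :=
  match c with
  | Zero n => GenTree.Node 0 [:: GenTree.Leaf n]
  | Succ => GenTree.Node 1 [::]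
  | Proj n i => GenTree.Node 2 [:: GenTree.Leaf n; GenTree.Leaf (nat_of_ord i)]
  | Oracle => GenTree.Node 3 [::]
  | Comp m n f g => GenTree.Node 4
      [:: GenTree.Leaf m, GenTree.Leaf n, code_tree f &
          [seq code_tree (g i) | i <- enum 'I_m]]
  | PrimRec _ f g => GenTree.Node 5 [:: code_tree f; code_tree g]
  | Mu _ f => GenTree.Node 6 [:: code_tree f]
  end.

Lemma existT_code_inj n (c d : code n) :
  existT code n c = existT code n d -> c = d.
Proof. exact: (inj_pair2_eq_dec _ (@eq_comparable nat)). Qed.

(** The trees over [nat] are countable, so this makes programs available to [pickle]. Dependent
    pairs are compared because the arities of subprograms must be recovered from the trees during
    the induction. *)
Lemma existT_code_tree_inj n (c : code n) m (d : code m) :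
  code_tree c = code_tree d -> existT code n c = existT code m d.
Proof.
elim: c m d => {n} [n||n i||m n f IHf g IHg|n f IHf g IHg|n f IHf] ?
  [p||p j||q p f' g'|p f' g'|p f'] //=.
- by case=> ->.
- by case=> enp; case: _ / enp j => j /val_inj ->.
- case=> emq enp; case: _ / emq f' g' => f'.
  case: _ / enp => g' /IHf/existT_code_inj -> /eq_in_map egg'.
  congr (existT _ _ (Comp _ _)); apply: functional_extensionality_dep => i.
  by apply/existT_code_inj/IHg/egg'; rewrite mem_enum.
- case=> /IHf ef /IHg eg; case: (ef) => enp _.
  case: _ / enp f' g' ef eg => f' g'.
  by move=> /existT_code_inj -> /existT_code_inj ->.
- case=> /IHf ef; case: (ef) => enp _.
  by case: _ / enp f' ef => f' /existT_code_inj ->.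
Qed.

Lemma code_tree_inj n : injective (@code_tree n).
Proof. by move=> c d /existT_code_tree_inj/existT_code_inj. Qed.

(** * Use principle and determinism of computations *)

Lemma uniform_bound n (P : 'I_n -> nat -> Prop) :
  (forall i u v, u <= v -> P i u -> P i v) ->
  (forall i, exists u, P i u) -> exists u, forall i, P i u.
Proof.
move=> mono /choice[u Pu]; exists (\max_i u i) => i.
by apply: mono (Pu i); apply: leq_bigmax.
Qed.

Definition agree (u : nat) (A B : pred nat) := forall x, x < u -> A x = B x.

Lemma agreeW u v A B : u <= v -> agree v A B -> agree u A B.
Proof. by move=> le_uv AB x xu; apply: AB; apply: leq_trans le_uv. Qed.

(** A halting computation consists of finitely many subcomputations, and the maximum of their use
    bounds serves for the whole. *)
Lemma eval_use A n (c : code n) x y :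
  eval A c x y -> exists u, forall B, agree u A B -> eval B c x y.
Proof.
elim: c x y => {n} [n||n i||m n f IHf g IHg|n f IHf g IHg|n f IHf] x y /=.
- by move=> ->; exists 0.
- by move=> ->; exists 0.
- by move=> ->; exists 0.
- by move=> ->; exists (thead x).+1 => B ->.
- case=> v gv /IHf[u fu].
  have [|i|w gw] := @uniform_bound _ (fun i w =>
    forall B, agree w A B -> eval B (g i) x (tnth v i)).
  + by move=> i a b ab ga B /(agreeW ab); apply: ga.
  + by apply: IHg.
  exists (maxn u w) => B AB; exists v => [i|].
    by apply: gw; apply: agreeW AB; rewrite leq_maxr.
  by apply: fu; apply: agreeW AB; rewrite leq_maxl.
- elim: (thead x) y => [|k IHk] y /=; first exact: IHf.
  case=> z /IHk[u zu] /IHg[w yw].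
  exists (maxn u w) => B AB; exists z.
    by apply: zu; apply: agreeW AB; rewrite leq_maxl.
  by apply: yw; apply: agreeW AB; rewrite leq_maxr.
- case=> /IHf[u fu] fz.
  have [|i|w gw] := @uniform_bound y (fun i w => exists v,
    forall B, agree w A B -> eval B f [tuple of (i : nat) :: x] v.+1).
  + by move=> i a b ab [v ga]; exists v => B /(agreeW ab); apply: ga.
  + by have [v /IHf[w ?]] := fz i (ltn_ord i); exists w, v.
  exists (maxn u w) => B AB; split.
    by apply: fu; apply: agreeW AB; rewrite leq_maxl.
  move=> z zy; have [v fv] := gw (Ordinal zy); exists v.
  by apply: fv; apply: agreeW AB; rewrite leq_maxr.
Qed.

Lemma eval_functional A n (c : code n) x y y' :
  eval A c x y -> eval A c x y' -> y = y'.
Proof.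
elim: c x y y' => {n} [n||n i||m n f IHf g IHg|n f IHf g IHg|n f IHf] x y y' /=.
- by move=> -> ->.
- by move=> -> ->.
- by move=> -> ->.
- by move=> -> ->.
- case=> v gv fv [v' gv' fv'].
  have vv' : v = v' by apply: eq_from_tnth => i; apply: IHg (gv i) (gv' i).
  by move: fv; rewrite vv' => fv; apply: IHf fv fv'.
- elim: (thead x) y y' => [|k IHk] y y' /=; first exact: IHf.
  case=> z kz gz [z' kz' gz'].
  by move: gz; rewrite (IHk _ _ kz kz') => gz; apply: IHg gz gz'.
- case=> fy ltfy [fy' ltfy']; case: (ltngtP y y') => // [/ltfy'|/ltfy] [v fv].
    by have := IHf _ _ _ fy fv.
  by have := IHf _ _ _ fy' fv.
Qed.

(** * Transitivity of Turing reducibility *)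

Fixpoint oracle_subst (d : code 1) n (c : code n) : code n :=
  match c in code n return code n with
  | Zero n => Zero n
  | Succ => Succ
  | Proj n i => Proj i
  | Oracle => d
  | Comp m n f g => Comp (oracle_subst d f) (fun i => oracle_subst d (g i))
  | PrimRec n f g => PrimRec (oracle_subst d f) (oracle_subst d g)
  | Mu n f => Mu (oracle_subst d f)
  end.

Lemma tuple1_thead (x : 1.-tuple nat) : x = [tuple thead x].
Proof. by apply: eq_from_tnth => i; rewrite ord1. Qed.

Lemma eval_oracle_subst (A B : pred nat) d :
  (forall x, eval B d [tuple x] (A x)) ->
  forall n (c : code n) x y, eval A c x y -> eval B (oracle_subst d c) x y.
Proof.
move=> dA n; elim=> {n} [n||n i||m n f IHf g IHg|n f IHf g IHg|n f IHf] x y //=.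
- by move=> ->; rewrite {1}(tuple1_thead x).
- by case=> v gv /IHf fv; exists v => // i; apply: IHg.
- elim: (thead x) y => [|k IHk] y /=; first exact: IHf.
  by case=> z /IHk kz /IHg gz; exists z.
- case=> /IHf fy ltfy; split=> // z /ltfy[v /IHf fv].
  by exists v.
Qed.

Lemma turing_le_refl A : turing_le A A.
Proof. by exists Oracle. Qed.

Lemma computable_in_trans A B f :
  turing_le A B -> computable_in A f -> computable_in B f.
Proof.
case=> d dA [c cf]; exists (oracle_subst d c) => x.
exact: (eval_oracle_subst dA).
Qed.

(** * Increasing enumeration of an infinite set from itself *)

Lemma eval_comp1 A n (f : code 1) (g : code n) x y z :
  eval A g x z -> eval A f [tuple z] y -> eval A (Comp f (fun=> g)) x y.
Proof. by move=> gz fy; exists [tuple z] => // i; rewrite ord1. Qed.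

Lemma eval_primrec A n (f : code n) g k x y :
  primrec_graph (eval A f) (eval A g) k x y ->
  eval A (PrimRec f g) [tuple of k :: x] y.
Proof.
suff tE : [tuple of behead [tuple of k :: x]] = x by rewrite /= theadE tE.
exact: val_inj.
Qed.

Definition comp2 n (f : code 2) (g h : code n) : code n :=
  Comp f (fun i : 'I_2 => if i == ord0 then g else h).

Lemma eval_comp2 A n (f : code 2) (g h : code n) x y z w :
  eval A g x z -> eval A h x w -> eval A f [tuple z; w] y ->
  eval A (comp2 f g h) x y.
Proof.
move=> gz hw fy; exists [tuple z; w] => // i; case: ifP => [/eqP->//|].
by case: i => [[|[]]].
Qed.

Definition add_code : code 2 :=
  PrimRec (Proj ord0) (Comp Succ (fun=> Proj (inord 1 : 'I_3))).

Lemma eval_add A k z : eval A add_code [tuple k; z] (k + z).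
Proof.
apply: eval_primrec; elim: k => [|k IHk]; first by rewrite /= (tnth_nth 0).
exists (k + z) => //; apply: eval_comp1 => //=.
by rewrite (tnth_nth 0) /= inordK.
Qed.

Definition neg_code : code 1 := PrimRec (Comp Succ (fun=> Zero 0)) (Zero 2).

Lemma eval_neg A (b : bool) : eval A neg_code [tuple (b : nat)] (~~ b).
Proof.
rewrite /= /thead (tnth_nth 0) /=; case: b => /=.
  by exists 1 => //; exists [tuple 0] => // i; rewrite ord1.
by exists [tuple 0] => // i; rewrite ord1.
Qed.

(** [Mu] searches for a zero, hence the negation: the least zero in the first argument leads to the
    least element of the oracle above [z]. *)
Definition skip_code : code 2 :=
  Comp neg_code (fun=> Comp Oracle (fun=> Comp Succ (fun=> add_code))).

Lemma eval_skip (A : pred nat) k z :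
  eval A skip_code [tuple k; z] (~~ A (k + z).+1).
Proof.
apply: eval_comp1 (eval_neg _ _); apply: (eval_comp1 (z := (k + z).+1)) => //.
by apply: (eval_comp1 (z := k + z)); first exact: eval_add.
Qed.

Definition next_code : code 1 :=
  Comp Succ (fun=> comp2 add_code (Mu skip_code) (Proj ord0)).

Lemma eval_next (A : pred nat) k z : A (k + z).+1 ->
  (forall j, A (j + z).+1 -> k <= j) -> eval A next_code [tuple z] (k + z).+1.
Proof.
move=> Ak mink; apply: (eval_comp1 (z := k + z)) => //.
apply: eval_comp2 (eval_add _ _ _) => //.
have tE j : [tuple of j :: [tuple z]] = [tuple j; z] by apply: val_inj.
split=> [|j jk]; first by rewrite tE; have := eval_skip A k z; rewrite Ak.
exists 0; rewrite tE; have := eval_skip A j z; case: (boolP (A _)) => //.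
by move/mink; rewrite leqNgt jk.
Qed.

Lemma computable_in_enumeration (A : pred nat) :
  (forall m, exists2 x, m <= x & A x) ->
  exists f,
    [/\ computable_in A f, {homo f : x y / x < y} & forall x, A (f x.+1)].
Proof.
move=> infA.
have nextP z : exists k, A (k + z).+1.
  by have [x zx Ax] := infA z.+1; exists (x - z.+1); rewrite -addnS subnK.
pose next z := (ex_minn (nextP z) + z).+1.
have nextA z : A (next z) by rewrite /next; case: ex_minnP.
(* The iteration starts at 0, which may lie outside [A]; only the values at successors are
   elements. *)
exists (fun x => iter x next 0); split=> [|x y|x]; last exact: nextA.
  exists (PrimRec (Zero 0) (Comp next_code (fun=> Proj (inord 1 : 'I_2)))) => x.
  apply: eval_primrec; elim: x => [|x IHx] //.
  exists (iter x next 0) => //; rewrite [iter x.+1 _ _]/=.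
  apply: (eval_comp1 (z := iter x next 0)).
    by rewrite /= (tnth_nth 0) /= inordK.
  by rewrite /next; case: ex_minnP => k; exact: eval_next.
apply: (@homo_ltn _ _ (fun x y => x < y)) => [b a c|a]; first exact: ltn_trans.
by rewrite /= ltnS leq_addl.
Qed.

(** * Generic sets and splittings *)

Definition extends (A : pred nat) (s : bitseq) :=
  agree (size s) (nth false s) A.

(* Rasiowa-Sikorski below the condition [Q]. *)
Lemma extends_generic (T : Type) (h : T -> nat) (Q : bitseq -> Prop)
    (P : T -> pred nat -> Prop) :
  injective h -> Q [::] ->
  (forall t s, Q s -> exists r,
     Q (s ++ r) /\ forall A, extends A (s ++ r) -> P t A) ->
  exists A, forall t, P t A.
Proof.
move=> h_inj Q0 dense.
(* Stage [n] meets the requirement numbered [n], if there is one. *)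
have stepP (ns : nat * bitseq) : exists r, Q ns.2 -> Q (ns.2 ++ r) /\
    forall t, h t = ns.1 -> forall A, extends A (ns.2 ++ r) -> P t A.
  case: ns => n s /=.
  have [Qs|nQs] := pselect (Q s); last by exists [::].
  have [[t ht]|noh] := pselect (exists t, h t = n); last first.
    by exists [::]; rewrite cats0; split=> // t ht; case: noh; exists t.
  have [r [? ?]] := dense t s Qs; exists r; split=> // t'.
  by rewrite -ht => /h_inj->.
have {stepP}[step stepP] := choice stepP.
pose fix S n := if n is k.+1 then S k ++ step (k, S k) else [::].
have QS n : Q (S n) by elim: n => //= n /(stepP (n, _))[].
have SD m n : exists r, S (m + n) = S n ++ r.
  elim: m => [|m [r Sr]]; first by exists [::]; rewrite cats0.
  by rewrite addSn /= Sr -catA; eexists.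
have nthS m n x : x < size (S m) -> x < size (S n) ->
    nth false (S m) x = nth false (S n) x.
  wlog le_nm : m n / n <= m => [hw xm xn|_ xn].
    by case/orP: (leq_total n m) => ?; [|apply/esym]; apply: hw.
  by have [r] := SD (m - n) n; rewrite subnK // => ->; rewrite nth_cat xn.
(* The limit of the strings [S n], with value false at positions that no string reaches. *)
exists (fun x => `[< exists2 n, x < size (S n) & nth false (S n) x >]) => t.
have [_] := stepP (h t, S (h t)) (QS _); apply=> // x xS.
apply/idP/asboolP => [Sx|[n xn]]; first by exists (h t).+1.
by rewrite (nthS _ (h t).+1).
Qed.

(* Beyond its length [s] is padded with zeros, so that membership in the cone
   also forbids elements between [size s] and [m]. *)
Definition cone (s : bitseq) m (A : pred nat) := agree m (nth false s) A.

Definition decides (s : bitseq) m (e : code 1) n y :=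
  exists2 A, cone s m A & eval A e [tuple n] y.

Definition splitting s m e := exists n y z,
  [/\ y <> z, decides s m e n y & decides s m e n z].

(* If [(s, m)] has no [e]-splitting, this is the only set that [e] can compute
   from an oracle in the cone of [(s, m)]. *)
Definition forced_set s m e : pred nat := fun n => `[< decides s m e n 1 >].

(** The oracle [A] itself decides every value of [C], so a disagreement with the forced set would be
    a splitting with values 0 and 1. *)
Lemma forced_setP s m e A C : ~ splitting s m e -> cone s m A ->
  (forall n, eval A e [tuple n] (nat_of_bool (C n))) -> C = forced_set s m e.
Proof.
move=> nsplit cA AC; apply: functional_extensionality_dep => n.
have dC : decides s m e n (C n) by exists A.
apply/idP/asboolP => [Cn|d1]; first by move: dC; rewrite Cn.
apply/negPn/negP => /negbTE nC; case: nsplit; exists n, 0, 1; split=> //.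
by move: dC; rewrite nC.
Qed.

(** [u] bounds the use of both computations. As [X] fills the interval from [m] to [u], either half,
    cut off at [u], adds to [s] only elements of [X]. *)
Definition has_splitting s e (X : pred nat) := exists m n y z u,
  [/\ size s <= m, y <> z, forall x, m <= x < u -> X x,
      exists2 A, cone s m A & forall B, agree u A B -> eval B e [tuple n] y &
      exists2 A, cone s m A & forall B, agree u A B -> eval B e [tuple n] z].

(** * The generic set [X] *)

Definition almost_injection (X : pred nat) (f : nat -> nat) :=
  injective f /\ forall x y, ~~ X (f x) -> ~~ X (f y) -> x = y.

(** Pigeonhole: [l.+1] consecutive arguments cannot all have values below [l]. *)
Lemma injective_unbounded f : injective f ->
  forall l m, exists2 x, m <= x & l <= f x.
Proof.
move=> f_inj l m; apply: contrapT => bnd.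
have sub : {subset map f (iota m l.+1) <= iota 0 l}.
  move=> y /mapP[x + ->]; rewrite mem_iota => /andP[mx _]; rewrite mem_iota /=.
  by rewrite add0n ltnNge; apply/negP => lx; apply: bnd; exists x.
have := uniq_leq_size _ sub.
by rewrite map_inj_uniq ?iota_uniq // size_map !size_iota ltnn => /(_ isT).
Qed.

Lemma exists_generic : exists X : pred nat,
  [/\ forall m, exists2 x, m <= x & X x,
      forall s e, (forall m, splitting s m e) -> has_splitting s e X &
      forall s m e f,
        computable_in (forced_set s m e) f -> ~ almost_injection X f].
Proof.
pose T := (nat + bitseq * code 1 + bitseq * nat * code 1 * code 1)%type.
pose h (t : T) : nat := match t with
  | inl (inl m) => pickle (0, m)
  | inl (inr (s, e)) => pickle (1, pickle (s, code_tree e))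
  | inr (s, m, e, c) => pickle (2, pickle (s, m, code_tree e, code_tree c))
  end.
have h_inj : injective h.
  move=> [[m|[s e]]|[[[s m] e] c]] [[m'|[s' e']]|[[[s' m'] e'] c']] /=;
    move=> /(pcan_inj pickleK) //.
  - by case=> ->.
  - by case=> /(pcan_inj pickleK)[-> /code_tree_inj->].
  - by case=> /(pcan_inj pickleK)[-> -> /code_tree_inj-> /code_tree_inj->].
pose P (t : T) (X : pred nat) : Prop := match t with
  | inl (inl m) => exists2 x, m <= x & X x
  | inl (inr (s, e)) => (forall m, splitting s m e) -> has_splitting s e X
  | inr (s, m, e, c) =>
      forall f, (forall x, eval (forced_set s m e) c [tuple x] (f x)) ->
      ~ almost_injection X f
  end.
have [//|t s _|X PX] := @extends_generic T h (fun=> True) P h_inj; last first.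
  exists X; split=> [m|s e|s m e f [c cf]].
  - exact: (PX (inl (inl m))).
  - exact: (PX (inl (inr (s, e)))).
  - exact: (PX (inr (s, m, e, c)) f).
case: t => [[m|[s' e]]|[[[s' m] e] c]].
- exists (nseq m.+1 true); split=> // A /(_ (size s + m)).
  rewrite size_cat size_nseq ltn_add2l ltnSn => /(_ isT) Am.
  exists (size s + m); first exact: leq_addl.
  by rewrite -Am nth_cat ltnNge leq_addr addKn nth_nseq ltnSn.
- have [spl|nspl] := pselect (forall m, splitting s' m e); last first.
    by exists [::]; split=> // A _ /nspl.
  (* Beyond the current condition [s] nothing is fixed yet, so the interval up to the use bound can
     be filled with ones. *)
  have [n [y [z [yz [A cA Ay] [B cB Bz]]]]] := spl (maxn (size s') (size s)).
  have [[u Au] [v Bv]] := (eval_use Ay, eval_use Bz).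
  exists (nseq (maxn u v) true); split=> // X sX _.
  exists (maxn (size s') (size s)), n, y, z, (maxn u v); split=> //.
  + exact: leq_maxl.
  + move=> x; rewrite geq_max => /andP[/andP[_ sx] xuv].
    rewrite -sX; last by rewrite size_cat size_nseq (leq_trans xuv) ?leq_addl.
    rewrite nth_cat ltnNge sx /= nth_nseq ifT //.
    exact: leq_ltn_trans (leq_subr _ _) xuv.
  + by exists A => // A' /(agreeW (leq_maxl u v)); apply: Au.
  + by exists B => // B' /(agreeW (leq_maxr u v)); apply: Bv.
(* If [c] computes an injection, two of its values lie beyond [s]; zeros at both leave two arguments
   with values outside [X]. *)
- have [[f [cf f_inj]]|nof] := pselect (exists f,
      (forall x, eval (forced_set s' m e) c [tuple x] (f x)) /\ injective f).
    have [x _ sx] := injective_unbounded f_inj (size s) 0.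
    have [y xy sy] := injective_unbounded f_inj (size s) x.+1.
    exists (nseq (maxn (f x) (f y)).+1 false); split=> // X sX f' cf' [_].
    have zeros z : size s <= z -> z <= maxn (f x) (f y) -> ~~ X z.
      move=> sz zxy; rewrite -sX.
        by rewrite nth_cat ltnNge sz nth_nseq if_same.
      by rewrite size_cat size_nseq addnS ltnS (leq_trans zxy) ?leq_addl.
    have ff' z : f' z = f z by apply: eval_functional (cf' z) (cf z).
    move=> /(_ x y); rewrite !ff' => eq_xy.
    by move: xy; rewrite eq_xy ?ltnn ?zeros ?leq_maxl ?leq_maxr.
  by exists [::]; split=> // X _ f cf [f_inj _]; apply: nof; exists f.
Qed.

(** * An infinite subset of [X] computing none of countably many sets *)

Lemma exists_subset_avoiding (X : pred nat) (C : nat -> pred nat) :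
  (forall m, exists2 x, m <= x & X x) ->
  (forall s e, (forall m, splitting s m e) -> has_splitting s e X) ->
  (forall i s m e, C i <> forced_set s m e) ->
  exists Y : pred nat, [/\ forall x, Y x -> X x,
    forall m, exists2 x, m <= x & Y x & forall i, ~ turing_le (C i) Y].
Proof.
move=> infX splitX nfC.
pose T := (nat + nat * code 1)%type.
pose h (t : T) : nat := match t with
  | inl m => pickle (0, m)
  | inr (i, e) => pickle (1, pickle (i, code_tree e))
  end.
have h_inj : injective h.
  move=> [m|[i e]] [m'|[i' e']] /= /(pcan_inj pickleK) //; first by case=> ->.
  by case=> /(pcan_inj pickleK)[-> /code_tree_inj->].
pose P (t : T) (Y : pred nat) : Prop := match t with
  | inl m => (Y m -> X m) /\ exists2 x, m <= x & Y x
  | inr (i, e) => ~ forall n, eval Y e [tuple n] (C i n)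
  end.
(* Conditions contain only elements of [X], and every position of [Y] gets decided by a condition,
   so [Y] stays inside [X]. *)
pose Q s := forall x, nth false s x -> X x.
have [x|t s Qs|Y PY] := @extends_generic T h Q P h_inj; [by rewrite nth_nil| |];
    last first.
  exists Y; split=> [x|m|i [e Ye]]; first exact: (PY (inl x)).1.
    exact: (PY (inl m)).2.
  exact: (PY (inr (i, e))) Ye.
have padQ k : Q (s ++ nseq k false).
  move=> x; rewrite nth_cat nth_nseq if_same; case: ifP => // _; exact: Qs.
case: t => [m|[i e]].
  have [x mx Xx] := infX (maxn m (size s)).
  move: mx; rewrite geq_max => /andP[mx sx].
  pose r := nseq (x - size s) false.
  have sz : size (s ++ r) = x by rewrite size_cat size_nseq subnKC.
  have Qr : Q (s ++ rcons r true).
    move=> z; rewrite -rcons_cat nth_rcons sz; case: ltngtP => // [_|-> //].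
    exact: padQ.
  exists (rcons r true); split=> // Y sY; split.
    by rewrite -sY; [apply: Qr|rewrite -rcons_cat size_rcons sz].
  by exists x => //; rewrite -sY -rcons_cat ?nth_rcons ?size_rcons sz ?ltnn ?eqxx.
(* Without a splitting at [m], padding [s] with zeros up to [m] puts [Y] in the cone, where [e] can
   only compute the forced set. *)
have [spl|/existsNP[m nspl]] := pselect (forall m, splitting s m e); last first.
  exists (nseq (m - size s) false); split=> // Y sY YC.
  apply: nfC (forced_setP nspl _ YC) => x xm.
  rewrite -sY ?nth_cat ?nth_nseq ?if_same.
    by case: ltnP => // sx; rewrite nth_default.
  by rewrite size_cat size_nseq -maxnE leq_max xm orbT.
have [m [n [y [z [u [sm yz Xu Ay Az]]]]]] := splitX s e spl.
(* At most one of the two split values equals [C i n]; the half giving a wrong value [w] is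
   chosen. *)
suff [w [wC [A cA Au]]] : exists w : nat, w <> C i n /\ exists2 A, cone s m A &
    forall B, agree u A B -> eval B e [tuple n] w.
  (* The part of [A] from [size s] to [u], empty if [u] is not beyond [size s]; hence the [maxn]
     below. *)
  pose r := mkseq (fun x => A (size s + x)) (u - size s).
  have nth_r x : nth false (s ++ r) x = (x < maxn (size s) u) && A x.
    rewrite nth_cat leq_max; case: ltnP => [xs|sx] /=.
      by rewrite -cA // (leq_trans xs).
    case: ltnP => xu; first by rewrite nth_mkseq ?subnKC // ltn_sub2rE.
    by rewrite nth_default // size_mkseq leq_sub2r.
  exists r; split=> [x|Y sY YC].
    rewrite nth_r => /andP[xu Ax]; have [xm|mx] := ltnP x m.
      by apply: Qs; rewrite cA.
    apply: Xu; rewrite mx /=; move: xu; rewrite leq_max.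
    by rewrite ltnNge (leq_trans sm mx).
  apply: wC; apply: eval_functional _ (YC n); apply: Au => x xu.
  have xsu : x < maxn (size s) u by rewrite leq_max xu orbT.
  by rewrite -sY ?nth_r ?xsu // size_cat size_mkseq -maxnE.
have [yC|/eqP yC] := eqVneq y (C i n); last by exists y.
by exists z; split=> // zC; apply: yz; rewrite yC zC.
Qed.

(** * The equivalence relations and the spectrum *)

Lemma infinite_classes (S : nat -> nat -> Prop) (f : nat -> nat) :
  Equivalence S -> (forall x y, x = y <-> S (f x) (f y)) ->
  infinite_set (classes S).
Proof.
move=> [reflS _ _] redf fin; apply: infinite_nat.
pose g x := [set y | S (f x) y]%classic.
have -> : [set: nat]%classic = (g @^-1` classes S)%classic.
  by apply/esym/seteqP; split=> // x _; exists (f x).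
apply: finite_preimage => // x y _ _ gxy; apply/redf.
by have : g y (f y) by []; rewrite -gxy.
Qed.

Definition merge_outside (X : pred nat) (x y : nat) :=
  x = y \/ ~~ X x && ~~ X y.

Lemma merge_outside_equivalence X : Equivalence (merge_outside X).
Proof.
split=> [x|x y [->|/andP[nx ny]]|x y z [->|/andP[nx ny]] [<-|/andP[ny' nz]]];
  by [left|right; apply/andP].
Qed.

Lemma almost_injectionP X f :
  almost_injection X f <-> forall x y, x = y <-> merge_outside X (f x) (f y).
Proof.
split=> [[f_inj fX] x y|redf].
  by split=> [->|[/f_inj//|/andP[]]]; [left|apply: fX].
split=> [x y fxy|x y nx ny]; first by apply/redf; left.
by apply/redf; right; apply/andP.
Qed.

Theorem corollary3p6 :
  exists R S : nat -> nat -> Prop,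
    [/\ Equivalence R, Equivalence S,
        infinite_set (classes R), infinite_set (classes S) &
        ~ exists2 B : set turing_degree, countable B & is_basis B (DgSp R S)].
Proof.
have [X [infX splitX nredX]] := exists_generic.
have red_enum (Y : pred nat) : (forall x, Y x -> X x) ->
    (forall m, exists2 x, m <= x & Y x) ->
    exists2 f, computable_in Y f & almost_injection X f.
  move=> YX /computable_in_enumeration[f [Yf f_mono Af]]; exists f => //.
  (* At most the value at 0 lies outside [X], which an almost injection permits. *)
  split=> [x y fxy|[|x] [|y] //]; rewrite ?[X (f _.+1)]YX //.
  by case: (ltngtP x y) => // /f_mono; rewrite fxy ltnn.
have eq_eqv : Equivalence (@eq nat) by split=> // x y z -> ->.
exists (@eq nat), (merge_outside X); split.
- exact: eq_eqv.
- exact: merge_outside_equivalence.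
- exact: (@infinite_classes _ id).
- have [f _ /almost_injectionP redf] := red_enum X (fun=> id) infX.
  exact: infinite_classes (merge_outside_equivalence X) redf.
case=> B /countable_injP[h h_inj] [_ specE].
have specB b : B b -> DgSp (@eq nat) (merge_outside X) b.
  move=> Bb; rewrite specE; exists b => //; case: (degree_classP b) => A bA.
  have refl : turing_equiv A A by split; apply: turing_le_refl.
  by exists A, A; rewrite bA; split=> //; apply: turing_le_refl.
have repP i : exists A : pred nat,
    (exists2 f, computable_in A f & almost_injection X f) /\
    forall b, B b -> h b = i -> degree_class b A.
  have [[b [Bb hb]]|nob] := pselect (exists b, B b /\ h b = i).
    have [f [A bA Af] /almost_injectionP redf] := specB b Bb.
    exists A; split=> [|b' Bb' hb']; first by exists f.
    by rewrite (h_inj b' b) ?hb ?in_setE.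
  exists X; split=> [|b Bb hb]; first exact: red_enum.
  by case: nob; exists b.
have [C CP] := choice repP.
have [|Y [YX infY CY]] := exists_subset_avoiding infX splitX (C := C).
  move=> i s m e CE; have [[f Cf redf] _] := CP i.
  by apply: (nredX s m e f) redf; rewrite -CE.
have YY : turing_equiv Y Y by split; apply: turing_le_refl.
pose d := TuringDegree (ex_intro _ Y (erefl [set A | turing_equiv Y A]%classic)).
have : DgSp (@eq nat) (merge_outside X) d.
  have [f Yf /almost_injectionP redf] := red_enum Y YX infY.
  by exists f => //; exists Y.
rewrite specE => -[b Bb [A [A' [bA [YA' A'Y] AA']]]].
(* The degree of [Y] lies above some [b] in [B], so [Y] computes the representative [C (h b)],
   through [A'], [A] and [A0]. *)
apply: (CY (h b)); have bC := (CP (h b)).2 b Bb erefl.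
have [A0 bE] := degree_classP b; move: bA bC; rewrite bE => -[A0A AA0] [A0C CA0].
apply: (computable_in_trans A'Y); apply: (computable_in_trans AA').
exact: computable_in_trans A0A CA0.
Qed.
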